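(* The orbitals for the action $H_N\subset S_{2N}$ of the hyperoctahedral group on the $2N$ endpoints of $N$ segments are as follows: (1) At $k=1$ there is $1$ orbit. (2) At $k=2$ there are $3$ orbitals. (3) At $k=3$ there are $11$ orbitals. (4) At $k=4$ there are $49$ orbitals.
   Context: $H_N=\mathbb Z_2\wr S_N$ is the symmetry group of the graph consisting of $N$ disjoint segments, acting by permuting the segments and switching their endpoints; this gives $H_N\subset S_{2N}$. The $k$-orbitals of a permutation group $G\subset S_M$ are the orbits of the diagonal action of $G$ on $\{1,\ldots,M\}^k$.
   Formalization: The count at each k is stated for N ≥ k; without this it is false (for N = 1 there are 2 orbitals at k = 2, for N = 2 there are 10 at k = 3, for N = 3 there are 48 at k = 4). *)

(* Defs.v *)
From mathcomp Require Import all_boot all_fingroup all_solvable.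

Set Implicit Arguments.
Unset Strict Implicit.
Unset Printing Implicit Defensive.

Local Open Scope group_scope.

Definition graph_aut_set (T : finType) (e : rel T) : {set {perm T}} :=
  [set p : {perm T} | [forall x, forall y, e (p x) (p y) == e x y]].

Lemma graph_aut_group_set (T : finType) (e : rel T) :
  group_set (graph_aut_set e).
Proof.
apply/group_setP; split=> [|p q].
  by rewrite inE; apply/forallP=> x; apply/forallP=> y; rewrite !perm1.
rewrite !inE => /forallP Hp /forallP Hq.
apply/forallP=> x; apply/forallP=> y; rewrite !permM.
by rewrite (eqP (forallP (Hq _) _)) (eqP (forallP (Hp _) _)).
Qed.

Canonical graph_aut_group (T : finType) (e : rel T) : {group {perm T}} :=
  Group (graph_aut_group_set e).

(* Segment number i, for i < N, has the endpoints i.*2 and i.*2.+1. *)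
Definition segments_graph (N : nat) : rel 'I_(2 * N) :=
  fun x y => (x != y) && (x./2 == y./2).

Definition hyperoctahedral_group (N : nat) : {group 'S_(2 * N)} :=
  [group of graph_aut_set (@segments_graph N)].

Definition orbitals (M : nat) (G : {group 'S_M}) (k : nat) :
    {set {set k.-tuple 'I_M}} :=
  orbit ('P * k) G @: [set: k.-tuple 'I_M].

(* Main.v *)
Require Import Defs.
From mathcomp Require Import all_boot all_fingroup all_solvable.
From mathcomp Require Import zify.

(** A symmetry of the segments is a permutation of the endpoints commuting with
the map [partner] that exchanges the two ends of each segment. Acting on a tuple
of endpoints, such symmetries can rename the segments in the order in which the
tuple first visits them, and orient each of them so that the end visited first
is the even one. Every orbit thus contains a tuple in which each entry is either
an end of one of the [m] segments already visited, that is a number below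
[m.*2], or the even end [m.*2] of the next segment: a restricted growth word
([growth_representative]). This word is unique, because a symmetry carrying one
growth word to another must fix the ends of each visited segment in turn
([growth_rigid]). Orbitals are therefore counted by growth words.

When there are enough segments, a growth word that has visited [m] of them
continues in [m.*2] ways without visiting a new one, and in one way with a new
one. This gives the recurrence [growth_count], whose values for [m = 0] are
1, 3, 11 and 49 at lengths 1, 2, 3 and 4: they are the sums over the set
partitions of [k] positions of the products of [2 ^ (b - 1)] over the block
sizes [b]. *)

Set Implicit Arguments.
Unset Strict Implicit.
Unset Printing Implicit Defensive.

Section Swap.
Variables (T : finType) (j : T -> T).
Hypotheses (jK : involutive j) (j_neq : forall x, j x != x).

(** Exchange the pair {x, j x} with the pair {z, j z}, or flip the pair if the
two coincide. With the conclusion on the remaining points, this lets a symmetry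
be built one segment at a time. *)
Lemma swap_commuting_involution (x z : T) :
  exists g : {perm T},
    [/\ forall y, g (j y) = j (g y), g x = z
      & forall y, y \notin [:: x; z; j x; j z] -> g y = y].
Proof.
have j_inj := can_inj jK.
have [z_jx | z_neq_jx] := eqVneq z (j x).
  exists (tperm x z); split=> [y||y]; last 2 first.
  - exact: tpermL.
  - by rewrite !inE !negb_or => /and4P[yx yz _ _]; rewrite tpermD // eq_sym.
  by rewrite (inj_tperm _ _ _ j_inj) z_jx jK tpermC.
have x_neq_jz : x != j z by rewrite -(inj_eq j_inj) jK eq_sym.
(* The two transpositions have disjoint supports unless z = x. *)
have swapC : commute (tperm x z) (tperm (j x) (j z)).
  apply/commgP/conjg_fixP; rewrite tpermJ.
  by rewrite !tpermD // eq_sym // eq_sym.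
exists (tperm x z * tperm (j x) (j z))%g; split=> [y||y].
- by rewrite {1}swapC !permM !(inj_tperm _ _ _ j_inj) !jK.
- by rewrite permM tpermL tpermD // eq_sym.
- rewrite !inE !negb_or => /and4P[yx yz yjx yjz].
  by rewrite permM !tpermD // eq_sym.
Qed.

End Swap.

Lemma partner_subproof N (x : 'I_(2 * N)) :
  (if odd x then x.-1 else x.+1) < 2 * N.
Proof. by case: x => x /= x_lt; case: ifP; lia. Qed.

Definition partner N (x : 'I_(2 * N)) : 'I_(2 * N) :=
  Ordinal (partner_subproof x).

Lemma partnerK N : involutive (@partner N).
Proof. by move=> x; apply: val_inj => /=; do 2!case: ifP; lia. Qed.

Lemma partner_neq N (x : 'I_(2 * N)) : partner x != x.
Proof. by rewrite -val_eqE /=; case: ifP; lia. Qed.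

Lemma segments_graphE N (x y : 'I_(2 * N)) :
  segments_graph x y = (y == partner x).
Proof. by rewrite /segments_graph -!val_eqE /=; case: ifP; lia. Qed.

Lemma hyperoctahedralP N (p : 'S_(2 * N)) :
  reflect (forall x, p (partner x) = partner (p x))
          (p \in hyperoctahedral_group N).
Proof.
apply: (iffP idP) => [|pj].
  rewrite inE => /forallP p_aut x; apply/eqP; rewrite -segments_graphE.
  by have /forallP/(_ (partner x))/eqP-> := p_aut x; rewrite segments_graphE.
rewrite inE; apply/forallP=> x; apply/forallP=> y.
by rewrite !segments_graphE -pj (inj_eq perm_inj).
Qed.

(** Restricted growth words for a tuple of endpoints, continuing one that has
already visited the segments numbered below [m]. *)
Fixpoint growth (m : nat) (w : seq nat) : bool :=
  if w is a :: w' then (a <= m.*2) && growth (m + (a == m.*2)) w' else true.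

(** Process the entries from left to right: an entry on a visited segment is
already as it should be, and an entry [x] on a new segment is moved to [m.*2] by
a swap that leaves the visited segments alone. The clause that [h] fixes these
is what allows the symmetries obtained for successive entries to be composed.
The segment numbered [m] exists because [m.*2 <= x < 2 * N]. *)
Lemma growth_representative N m (s : seq 'I_(2 * N)) :
  exists2 h : 'S_(2 * N), h \in hyperoctahedral_group N
    & (forall y : 'I_(2 * N), y < m.*2 -> h y = y)
      /\ growth m [seq val (h x) | x <- s].
Proof.
have [n] := ubnP (size s); elim: n m s => // n IHn m [|x s] /= s_lt.
  by exists 1%g; rewrite ?group1 //; split=> // y _; rewrite perm1.
have [x_old | x_new] := ltnP x m.*2.
  have [h hH [h_fix h_growth]] := IHn m s s_lt.
  exists h => //; split=> //=.
  by rewrite h_fix //= (ltnW x_old) (ltn_eqF x_old) addn0.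
have m_lt : m.*2 < 2 * N by apply: leq_ltn_trans x_new (ltn_ord x).
pose z : 'I_(2 * N) := Ordinal m_lt.
have [g [gj gx g_fix]] :=
  swap_commuting_involution (@partnerK N) (@partner_neq N) x z.
have gH : g \in hyperoctahedral_group N by apply/hyperoctahedralP.
have [|h hH [h_fix h_growth]] := IHn m.+1 (map g s); first by rewrite size_map.
exists (g * h)%g; first exact: groupM.
split=> [y y_lt|/=].
  rewrite permM g_fix ?h_fix //; first lia.
  by rewrite !inE -!val_eqE /=; do 2!case: ifP; lia.
rewrite permM gx h_fix /= ?leqnn ?eqxx ?addn1; last lia.
move: h_growth; rewrite -map_comp.
by congr growth; apply: eq_map => y /=; rewrite permM.
Qed.

(** If the first entry is below [m.*2] then it is fixed by assumption. Otherwise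
it is [m.*2], and its image, which cannot lie in the fixed range by injectivity,
must be [m.*2] too; commuting with [partner] then fixes the other end of that
segment, so the assumption holds for [m.+1]. *)
Lemma growth_rigid N m (h : 'S_(2 * N)) (s : seq 'I_(2 * N)) :
    h \in hyperoctahedral_group N ->
    (forall y : 'I_(2 * N), y < m.*2 -> h y = y) ->
  growth m (map val s) -> growth m [seq val (h x) | x <- s] -> map h s = s.
Proof.
move=> /hyperoctahedralP hj; elim: s m => //= x s IHs m h_fix.
case/andP=> x_le s_growth /andP[hx_le hs_growth].
have hx : h x = x.
  have [/h_fix // | x_new] := ltnP x m.*2.
  have [/h_fix/perm_inj // | hx_new] := ltnP (h x) m.*2.
  by apply: val_inj => /=; lia.
rewrite hx; congr (_ :: _).
apply: IHs s_growth _ => [y|]; last by rewrite hx in hs_growth.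
have [/= x_top y_lt | _] := eqVneq (val x) m.*2; last first.
  by rewrite addn0; apply: h_fix.
have [/h_fix // | y_ge] := ltnP y m.*2.
have [-> // | y_neq] := eqVneq y x.
(* y lies in {m.*2, m.*2.+1} and x is the former. *)
have -> : y = partner x.
  apply: val_inj; move: y_neq y_lt.
  by rewrite -val_eqE addn1 /=; case: ifP; lia.
by rewrite hj hx.
Qed.

Lemma card_orbitals_growth N k :
  #|orbitals (hyperoctahedral_group N) k|
    = #|[set t : k.-tuple 'I_(2 * N) | growth 0 (map val t)]|.
Proof.
set H := hyperoctahedral_group N; set W := [set t | _].
have -> : orbitals H k = orbit ('P * k) H @: W.
  apply/eqP; rewrite eqEsubset andbC imsetS ?subsetT //=.
  apply/subsetP=> _ /imsetP[t _ ->].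
  have [h hH [_ h_growth]] := growth_representative 0 t.
  apply/imsetP; exists (('P * k)%act t h).
    by rewrite inE /= -map_comp.
  by apply/esym/orbit_eqP; apply: mem_orbit.
apply: card_in_imset => s t; rewrite !inE => s_growth t_growth /esym st.
have /orbitP[h hH def_t] : t \in orbit ('P * k) H s by apply/orbit_eqP.
apply: val_inj; rewrite -def_t /=.
apply/esym/(growth_rigid (m := 0) hH) => //.
by move: t_growth; rewrite -def_t /= -map_comp.
Qed.

Fixpoint growth_count (m k : nat) : nat :=
  if k is k'.+1 then m.*2 * growth_count m k' + growth_count m.+1 k' else 1.

(** Split according to the first entry: below [m.*2], equal to [m.*2], or above.
The bound [m + k <= N] guarantees that [m.*2] is an endpoint, and is inherited
by the remaining [k.-1] entries in both nonempty cases. *)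
Lemma card_growth N m k : m + k <= N ->
  #|[set t : k.-tuple 'I_(2 * N) | growth m (map val t)]| = growth_count m k.
Proof.
elim: k m => [|k IHk] m mk_le /=.
  rewrite cardsE; apply: etrans (card_tuple 0 'I_(2 * N)).
  by apply: eq_card => t; rewrite tuple0 !inE.
have sum_growth m' : m' + k <= N ->
    \sum_(t : k.-tuple 'I_(2 * N)) growth m' (map val t) = growth_count m' k.
  move=> m'k_le; rewrite -IHk // cardsE -sum1_card [RHS]big_mkcond /=.
  by apply: eq_bigr => t _; rewrite -topredE /=; case: growth.
pose cons_pair (p : 'I_(2 * N) * k.-tuple 'I_(2 * N)) := [tuple of p.1 :: p.2].
have cons_bij : bijective cons_pair.
  exists (fun t => (thead t, [tuple of behead t])) => [[x t]|t].
    by congr pair; apply: val_inj.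
  by rewrite /cons_pair -tuple_eta.
rewrite cardsE -sum1_card big_mkcond (reindex cons_pair) /=; last exact: onW_bij.
rewrite -(pair_bigA _ (fun x t => growth m (map val (x :: val t)) : nat)) /=.
have inner (x : 'I_(2 * N)) :
    \sum_(t : k.-tuple 'I_(2 * N)) growth m (map val (x :: val t))
    = (if x < m.*2 then growth_count m k else 0)
      + (if x == m.*2 :> nat then growth_count m.+1 k else 0).
  rewrite /=; case: ltngtP => [x_lt|x_gt|x_eq] /=.
  - by rewrite !addn0; apply: sum_growth; lia.
  - by rewrite big1.
  - by rewrite addn1; apply: sum_growth; lia.
rewrite (eq_bigr _ (fun x _ => inner x)) big_split /=.
have m_lt : m.*2 < 2 * N by lia.
congr (_ + _).
  rewrite -big_mkcond -(big_ord_widen _ (fun=> growth_count m k)) //;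
    last exact: ltnW.
  by rewrite sum_nat_const card_ord.
by rewrite -big_mkcond (big_pred1 (Ordinal m_lt)).
Qed.

Lemma card_orbitals_hyperoctahedral N k : k <= N ->
  #|orbitals (hyperoctahedral_group N) k| = growth_count 0 k.
Proof. by move=> k_le; rewrite card_orbitals_growth card_growth. Qed.

Theorem proposition8p3 (N : nat) :
  [/\ 1 <= N -> #|orbitals (hyperoctahedral_group N) 1| = 1,
      2 <= N -> #|orbitals (hyperoctahedral_group N) 2| = 3,
      3 <= N -> #|orbitals (hyperoctahedral_group N) 3| = 11
    & 4 <= N -> #|orbitals (hyperoctahedral_group N) 4| = 49].
Proof. by split=> le_kN; rewrite card_orbitals_hyperoctahedral. Qed.
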